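(* Let $A=[a_1\ \cdots\ a_n]\in\mathbb{R}^{m\times n}$ with $\|a_i\|=1$ for $i=1,\dots,n$, and assume $x_0\in\Delta_{n-1}$ is one of the extreme points of $\Delta_{n-1}$. Run the von Neumann Algorithm with Away Steps (described in the context) on $A$ from $x_0$. (a) If $0\in\operatorname{conv}(A)$, then the iterates $x_k\in\Delta_{n-1}$, $y_k=Ax_k$, $k=1,2,\dots$, generated by the algorithm satisfy $$\|y_k\|^2\le\left(1-\frac{w(A)^2}{16}\right)^{k/2}\|y_0\|^2 .$$ (b) The iterates $x_k\in\Delta_{n-1}$, $y_k=Ax_k$, $k=1,2,\dots$, generated by the algorithm also satisfy $$\|y_k\|^2\le\frac{8}{k}$$ as long as the algorithm has not halted. In particular, if $0\notin\operatorname{conv}(A)$, then the algorithm finds a certificate of infeasibility $A^{\mathrm T}y_k>0$ for $0\notin\operatorname{conv}(A)$ in at most $\frac{8}{\rho(A)^2}$ iterations.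
   Context: $\|\cdot\|$ is the Euclidean norm and $\langle\cdot,\cdot\rangle$ the standard inner product. $\Delta_{n-1}=\{x\in\mathbb{R}^n: x\ge 0,\ \|x\|_1=1\}$; its extreme points are the standard basis vectors $e_1,\dots,e_n$. $\operatorname{conv}(A)=\operatorname{conv}\{a_1,\dots,a_n\}$. For $x\in\mathbb{R}^n$ with $x\ge0$, the support is $S(x)=\{i\in\{1,\dots,n\}: x_i>0\}$. Vector inequalities such as $A^{\mathrm T}y>0$ are componentwise and strict in every component. Relative width: $$w(A)=\min_{x\ge 0,\ Ax\ne 0}\ \max_{\ell,j}\left\{\frac{\langle Ax,a_\ell-a_j\rangle}{\|Ax\|}:\ \ell\in S(x),\ j\in\{1,\dots,n\}\right\}.$$ Condition measure: $$\rho(A)=\max_{z\in\mathbb{R}^m,\ \|z\|=1}\ \min_{i=1,\dots,n}\langle a_i,z\rangle .$$ Von Neumann Algorithm with Away Steps. Start with $x_0\in\Delta_{n-1}$, $y_0=Ax_0$. For $k=0,1,2,\dots$: - If $A^{\mathrm T}y_k>0$, HALT (then $0\notin\operatorname{conv}(A)$). - Choose $j\in\operatorname{argmin}_{i=1,\dots,n}\langle a_i,y_k\rangle$ and $\ell\in\operatorname{argmax}_{i\in S(x_k)}\langle a_i,y_k\rangle$ (ties broken arbitrarily). - If $\langle a_j-y_k,y_k\rangle<\langle y_k-a_\ell,y_k\rangle$ (regular step), set $a=a_j-y_k$, $u=e_j-x_k$, $\theta_{\max}=1$. Otherwise (away step), set $a=y_k-a_\ell$, $u=x_k-e_\ell$,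 $\theta_{\max}=\frac{(x_k)_\ell}{1-(x_k)_\ell}$. - Choose $\theta_k\in\operatorname{argmin}_{\theta\in[0,\theta_{\max}]}\|y_k+\theta a\|$, and set $x_{k+1}=x_k+\theta_k u$, $y_{k+1}=Ax_{k+1}$. *)

(* Defs.v *)
(* Vectors of R^n are columns 'cV[R]_n, and a_i is the i-th column of
   A : 'M[R]_(m, n). *)
From mathcomp Require Export all_boot all_order all_algebra.
From mathcomp Require Export boolp classical_sets reals exp.

Set Implicit Arguments.
Unset Strict Implicit.
Unset Printing Implicit Defensive.

Import Order.TTheory GRing.Theory Num.Theory.
Local Open Scope classical_set_scope.
Local Open Scope ring_scope.

Definition dot (R : realType) (m : nat) (u v : 'cV[R]_m) : R :=
  \sum_(i < m) u i 0 * v i 0.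

(* The norm `|u| that the library puts on matrices is the sup norm, whence a
   separate Euclidean norm. *)
Definition enorm (R : realType) (m : nat) (u : 'cV[R]_m) : R :=
  Num.sqrt (dot u u).

Definition simplex (R : realType) (n : nat) : set 'cV[R]_n :=
  [set x | (forall i, 0 <= x i 0) /\ \sum_(i < n) `|x i 0| = 1].

Definition extreme_point (R : realType) (n : nat) (C : set 'cV[R]_n)
    (x : 'cV[R]_n) : Prop :=
  C x /\ forall (u v : 'cV[R]_n) (t : R), C u -> C v -> 0 < t < 1 ->
    x = t *: u + (1 - t) *: v -> u = v.

Definition ebasis (R : realType) (n : nat) (i : 'I_n) : 'cV[R]_n :=
  delta_mx i 0.

Definition conv_cols (R : realType) (m n : nat) (A : 'M[R]_(m, n)) :
    set 'cV[R]_m :=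
  [set A *m x | x in @simplex R n].

Definition support (R : realType) (n : nat) (x : 'cV[R]_n) : set 'I_n :=
  [set i | 0 < x i 0].

(* max_(l in S(x), j) <Ax, a_l - a_j> / ||Ax||.  The sup is over a finite set,
   nonempty whenever x >= 0 and Ax != 0, so it is a maximum. *)
Definition width_at (R : realType) (m n : nat) (A : 'M[R]_(m, n))
    (x : 'cV[R]_n) : R :=
  sup [set r | exists l j, support x l /\
    r = dot (A *m x) (col l A - col j A) / enorm (A *m x)].

(* The inf is attained as soon as A has a nonzero column: for a fixed support
   the value depends on the direction of Ax only, and it can only drop when
   that direction tends to one generated by fewer columns. *)
Definition relative_width (R : realType) (m n : nat) (A : 'M[R]_(m, n)) : R :=
  inf [set width_at A x | x in
    [set x : 'cV[R]_n | (forall i, 0 <= x i 0) /\ A *m x != 0]].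

(* For m, n > 0 the inf is over a finite nonempty set, and the sup is that of a
   continuous function on the unit sphere: they are a minimum and a maximum. *)
Definition condition_measure (R : realType) (m n : nat) (A : 'M[R]_(m, n)) : R :=
  sup [set inf [set dot (col i A) z | i in [set: 'I_n]] | z in
    [set z : 'cV[R]_m | enorm z = 1]].

Definition halts (R : realType) (m n : nat) (A : 'M[R]_(m, n))
    (x : 'cV[R]_n) : bool :=
  [forall i, 0 < (A^T *m (A *m x)) i 0].

Definition line_min (R : realType) (m : nat) (y a : 'cV[R]_m)
    (tmax theta : R) : Prop :=
  0 <= theta <= tmax /\
  forall t, 0 <= t <= tmax -> enorm (y + theta *: a) <= enorm (y + t *: a).

(* One iteration from x to x'; a relation, since ties in the choices of j, l and
   theta are broken arbitrarily.  When the columns of A are unit vectors and x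
   is a non-halting point of the simplex, no away step has x l 0 = 1: that
   would force x = e_l and y = a_l, hence <a_j, y> <= 0 < <y, y> for the
   chosen j (if min_i <a_i, y> > 0 the algorithm halts) and a regular step. *)
Definition vn_step (R : realType) (m n : nat) (A : 'M[R]_(m, n))
    (x x' : 'cV[R]_n) : Prop :=
  let y := A *m x in
  exists j l : 'I_n, exists theta : R,
    [/\ forall i, dot (col j A) y <= dot (col i A) y,
        support x l,
        forall i, support x i -> dot (col i A) y <= dot (col l A) y
      & if dot (col j A - y) y < dot (y - col l A) y
        then line_min y (col j A - y) 1 theta /\
             x' = x + theta *: (ebasis R j - x)
        else line_min y (y - col l A) (x l 0 / (1 - x l 0)) theta /\
             x' = x + theta *: (x - ebasis R l)].

(* The sequence x_0, x_1, ... produced by the algorithm, extended by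
   stationarity after the halting iterate, if there is one. *)
Definition vn_run (R : realType) (m n : nat) (A : 'M[R]_(m, n))
    (x0 : 'cV[R]_n) (x : nat -> 'cV[R]_n) : Prop :=
  x 0%N = x0 /\
  forall k, if halts A (x k) then x k.+1 = x k else vn_step A (x k) (x k.+1).

(* Main.v *)
(* Write s = |y|^2 and p = - <a, y> for the chosen direction a.  As |a| <= 2, a
   line search that is not cut short by theta_max brings s down to at most
   s - p^2 / 4, where p >= s and, a being the better of the two candidates,
   p >= w(A) |y| / 2.  Only an away step can be cut short, and then the support
   of x loses an element while s does not increase.  A step adds at most one
   element to the support, which starts as a singleton, so among k steps at
   least k / 2 make the full progress.  This gives (a), and (b) through
   s' <= s - s^2 / 4.  If 0 is not in conv(A), compactness keeps s away from 0,
   so the algorithm halts; the halting iterate shows rho(A) > 0, and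
   rho(A) <= |A x| on the simplex turns (b) into the iteration bound. *)
Require Import Defs.
From mathcomp Require Import ring lra zify.
From mathcomp Require Import topology normedtype derive.
Set Implicit Arguments.
Unset Strict Implicit.
Unset Printing Implicit Defensive.

Import Order.TTheory GRing.Theory Num.Theory.
Import numFieldNormedType.Exports.
Local Open Scope classical_set_scope.
Local Open Scope ring_scope.

(** * Euclidean inner product and exact line search *)

Section InnerProduct.
Variables (R : realType) (m : nat).
Implicit Types (u v w y d : 'cV[R]_m) (a p : R).

Lemma dotC u v : dot u v = dot v u.
Proof. by apply: eq_bigr => i _; rewrite mulrC. Qed.

Lemma dotDl u v w : dot (u + v) w = dot u w + dot v w.
Proof. by rewrite -big_split; apply: eq_bigr => i _; rewrite !mxE mulrDl. Qed.

Lemma dotZl a u v : dot (a *: u) v = a * dot u v.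
Proof. by rewrite mulr_sumr; apply: eq_bigr => i _; rewrite !mxE mulrA. Qed.

Lemma dotDr u v w : dot w (u + v) = dot w u + dot w v.
Proof. by rewrite dotC dotDl !(dotC w). Qed.

Lemma dotZr a u v : dot u (a *: v) = a * dot u v.
Proof. by rewrite dotC dotZl dotC. Qed.

Lemma dotNl u v : dot (- u) v = - dot u v.
Proof. by rewrite -scaleN1r dotZl mulN1r. Qed.

Lemma dotNr u v : dot u (- v) = - dot u v.
Proof. by rewrite dotC dotNl dotC. Qed.

Definition dotE := (dotDl, dotDr, dotNl, dotNr, dotZl, dotZr).

Lemma dot0l v : dot 0 v = 0.
Proof. by rewrite -(scale0r (0 : 'cV[R]_m)) dotZl mul0r. Qed.

Lemma dot0r v : dot v 0 = 0.
Proof. by rewrite dotC dot0l. Qed.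

Lemma dot_ge0 u : 0 <= dot u u.
Proof. by apply: sumr_ge0 => i _; rewrite -expr2 sqr_ge0. Qed.

Lemma dot_eq0 u : (dot u u == 0) = (u == 0).
Proof.
apply/eqP/eqP => [|->]; last exact: dot0l.
move/psumr_eq0P => u0; apply/matrixP => i j; rewrite ord1 mxE.
have /eqP := u0 (fun i _ => sqr_ge0 (u i 0)) i isT.
by rewrite mulf_eq0 orbb => /eqP.
Qed.

Lemma enorm_sqr u : enorm u ^+ 2 = dot u u.
Proof. by rewrite sqr_sqrtr ?dot_ge0. Qed.

Lemma enorm_ge0 u : 0 <= enorm u.
Proof. exact: sqrtr_ge0. Qed.

Lemma enorm_gt0 u : (0 < enorm u) = (u != 0).
Proof. by rewrite sqrtr_gt0 lt_def dot_eq0 dot_ge0 andbT. Qed.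

Lemma enorm_eq1 u : enorm u = 1 -> dot u u = 1.
Proof. by rewrite -enorm_sqr => ->; rewrite expr1n. Qed.

Lemma le_enorm u v : (enorm u <= enorm v) = (dot u u <= dot v v).
Proof. by rewrite ler_sqrt ?dot_ge0. Qed.

Lemma dot_le_mean u v : dot u v <= (dot u u + dot v v) / 2.
Proof. by have := dot_ge0 (u - v); rewrite !dotE (dotC v u); lra. Qed.

Lemma dot_le_enorm u v : dot u v <= enorm u * enorm v.
Proof.
have [->|u0] := eqVneq u 0; first by rewrite dot0l mulr_ge0 ?enorm_ge0.
have [->|v0] := eqVneq v 0; first by rewrite dot0r mulr_ge0 ?enorm_ge0.
have := dot_ge0 (enorm v *: u - enorm u *: v).
rewrite !dotE (dotC v u) -!enorm_sqr => h.
have p : 0 < enorm u * enorm v by rewrite mulr_gt0 ?enorm_gt0.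
rewrite -(ler_pM2l p); nra.
Qed.

(* A step of length [p / 4] already achieves the decrease [p ^+ 2 / 4]. *)
Lemma line_min_decrease y d tmax theta p :
  line_min y d tmax theta -> dot d d <= 4 -> 0 <= p -> dot d y = - p ->
  (theta = tmax /\ tmax < p / 4) \/
  dot (y + theta *: d) (y + theta *: d) <= dot y y - p ^+ 2 / 4.
Proof.
move=> [/andP[t0 tm] min] d4 p0 dyE.
have qE t : dot (y + t *: d) (y + t *: d) = dot y y - 2 * t * p + t ^+ 2 * dot d d.
  by rewrite !dotE (dotC y d) dyE; ring.
have d0 := dot_ge0 d.
have [pm|mp] := leP (p / 4) tmax.
  right; have /min : 0 <= p / 4 <= tmax by rewrite pm divr_ge0.
  rewrite le_enorm => /le_trans; apply; rewrite qE.
  by have := ler_wpM2l (sqr_ge0 (p / 4)) d4; rewrite -subr_ge0; lra.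
left; split=> //; apply/eqP; rewrite eq_le tm /= leNgt; apply/negP => tlt.
have /min : 0 <= tmax <= tmax by rewrite lexx (le_trans t0 tm).
rewrite le_enorm !qE.
have : (tmax + theta) * dot d d <= (tmax + theta) * 4 by rewrite ler_wpM2l //; lra.
move=> h1 h2.
(* This product is the drop of the quadratic from [theta] to [tmax]; it is positive because 4 (tmax
   + theta) < 8 tmax < 2 p, so stopping before [tmax] contradicts minimality. *)
have : 0 < (tmax - theta) * (2 * p - (tmax + theta) * dot d d).
  by apply: mulr_gt0; lra.
by move: h2; rewrite !expr2; nra.
Qed.

Lemma line_min_le y d tmax theta :
  line_min y d tmax theta ->
  dot (y + theta *: d) (y + theta *: d) <= dot y y.
Proof.
move=> [/andP[t0 tm] min]; have /min : 0 <= (0 : R) <= tmax.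
  by rewrite lexx (le_trans t0 tm).
by rewrite le_enorm scale0r addr0.
Qed.

End InnerProduct.

(** * The simplex, supports and extreme points *)

Section Simplex.
Variables (R : realType) (n : nat).
Implicit Types x u v : 'cV[R]_n.

Lemma simplexP x :
  @simplex R n x <-> (forall i, 0 <= x i 0) /\ \sum_i x i 0 = 1.
Proof.
suff e : (forall i, 0 <= x i 0) -> \sum_i `|x i 0| = \sum_i x i 0.
  by split=> -[x0 x1]; split=> //; rewrite -?e // e.
by move=> x0; apply: eq_bigr => i _; rewrite ger0_norm.
Qed.

Definition supp_card x : nat := #|[pred i | 0 < x i 0]|.

Lemma simplex_supp_gt0 x : @simplex R n x -> (0 < supp_card x)%N.
Proof.
move=> /simplexP[x0 x1]; rewrite lt0n; apply/negP => /eqP/card0_eq s0.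
have : \sum_i x i 0 <= 0.
  apply: sumr_le0 => i _.
  by rewrite leNgt -[_ < _]/(i \in [pred i | 0 < x i 0]) s0.
by rewrite x1 ler10.
Qed.

Lemma simplex_index x : @simplex R n x -> exists i : 'I_n, true.
Proof. by move=> /simplex_supp_gt0/card_gt0P[i _]; exists i. Qed.

Lemma simplex_le1 x i : @simplex R n x -> x i 0 <= 1.
Proof.
by move=> /simplexP[x0 <-]; rewrite (bigD1 i) //= lerDl sumr_ge0.
Qed.

Lemma sum_ebasis (i : 'I_n) : \sum_k ebasis R i k 0 = 1.
Proof.
rewrite (bigD1 i) //= mxE !eqxx big1 ?addr0 // => k ki.
by rewrite mxE (negPf ki).
Qed.

Lemma sum_translate x u v t :
  \sum_i (x + t *: (u - v)) i 0 =
  \sum_i x i 0 + t * (\sum_i u i 0 - \sum_i v i 0).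
Proof.
by under eq_bigr do rewrite !mxE; rewrite big_split -mulr_sumr sumrB.
Qed.

Lemma simplex_eq_ebasis x i : @simplex R n x -> x i 0 = 1 -> x = ebasis R i.
Proof.
move=> /simplexP[x0]; rewrite (bigD1 i) //= => + xi.
rewrite xi -[RHS]addr0 => /addrI/psumr_eq0P h.
apply/matrixP => k j; rewrite ord1 !mxE eqxx andbT.
by case: eqVneq => [->|ki]; rewrite ?xi // (h (fun k _ => x0 k)).
Qed.

(** Two positive entries would allow mass to be moved between them in either direction, making x the
    midpoint of two distinct points of the simplex. *)
Lemma extreme_supp_card x :
  extreme_point (@simplex R n) x -> (supp_card x <= 1)%N.
Proof.
move=> [xS xE]; rewrite leqNgt; apply/negP => /card_gt1P[i [j [/= xi xj ij]]].
have /simplexP[x0 x1] := xS.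
rewrite !inE in xi xj.
pose e := Num.min (x i 0) (x j 0).
have e0 : 0 < e by rewrite lt_min xi.
have ei : e <= x i 0 by rewrite ge_min lexx.
have ej : e <= x j 0 by rewrite ge_min lexx orbT.
pose d := e *: (ebasis R i - ebasis R j).
have dE k : d k 0 = e * (ebasis R i k 0 - ebasis R j k 0) by rewrite !mxE.
have dS : \sum_k d k 0 = 0.
  under eq_bigr do rewrite dE.
  by rewrite -mulr_sumr sumrB !sum_ebasis subrr mulr0.
(* The two-sided bound keeps both x + d and x - d nonnegative; this is why [e] is the smaller of the
   two entries. *)
have dk k : - x k 0 <= d k 0 <= x k 0.
  rewrite dE !mxE !eqxx !andbT; have := x0 k.
  case: (eqVneq k i) ij => [->|_] ij; first by rewrite (negPf ij) /=; lra.
  by case: (eqVneq k j) => [->|_] /=; lra.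
have di : 0 < d i 0 by rewrite dE !mxE !eqxx (negPf ij) /= subr0 mulr1.
clearbody d; have : x + d = x - d.
  apply: (xE _ _ 2^-1).
  - apply/simplexP; split=> [k|]; first by rewrite mxE; have := dk k; lra.
    by under eq_bigr do rewrite mxE; rewrite big_split /= x1 dS addr0.
  - apply/simplexP; split=> [k|]; first by rewrite !mxE; have := dk k; lra.
    by under eq_bigr do rewrite !mxE; rewrite sumrB x1 dS subr0.
  - by lra.
  - by apply/matrixP => k l; rewrite !mxE; lra.
by move/matrixP/(_ i 0); rewrite !mxE; lra.
Qed.

End Simplex.

(** * Convex combinations of unit columns *)

Section Iteration.
Variables (R : realType) (m n : nat) (A : 'M[R]_(m, n)).
Hypothesis hA : forall i, enorm (col i A) = 1.
Implicit Types (x : 'cV[R]_n) (v : 'cV[R]_m).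

Let dotA i : dot (col i A) (col i A) = 1.
Proof. exact: enorm_eq1. Qed.

Lemma dot_mulmx x v : dot (A *m x) v = \sum_i x i 0 * dot (col i A) v.
Proof.
rewrite /dot; under eq_bigr do rewrite mxE mulr_suml.
rewrite exchange_big /=; apply: eq_bigr => i _; rewrite mulr_sumr.
by apply: eq_bigr => k _; rewrite mxE mulrA (mulrC (A k i)).
Qed.

Lemma dot_simplex_le x v c : @simplex R n x ->
  (forall i, support x i -> dot (col i A) v <= c) -> dot (A *m x) v <= c.
Proof.
move=> /simplexP[x0 x1] h; rewrite dot_mulmx -[c]mul1r -x1 mulr_suml.
apply: ler_sum => i _; have := x0 i; rewrite le_eqVlt => /orP[/eqP<-|xi].
  by rewrite !mul0r.
by rewrite ler_pM2l // h.
Qed.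

Lemma dot_simplex_ge x v c : @simplex R n x ->
  (forall i, c <= dot (col i A) v) -> c <= dot (A *m x) v.
Proof.
move=> xS h; rewrite -lerN2 -dotNr; apply: dot_simplex_le => // i _.
by rewrite dotNr lerN2.
Qed.

Lemma haltsE x : halts A x = [forall i, 0 < dot (col i A) (A *m x)].
Proof.
apply: eq_forallb => i; rewrite mxE /dot; congr (_ < _).
by apply: eq_bigr => k _; rewrite !mxE.
Qed.

(** Averaging <a_i, y> <= (1 + |y|^2) / 2 with the weights x_i bounds |y|^2 by the same right-hand
    side. *)
Lemma simplex_dot_le1 x : @simplex R n x -> dot (A *m x) (A *m x) <= 1.
Proof.
move=> xS; set y := A *m x.
have : dot y y <= (1 + dot y y) / 2.
  by apply: dot_simplex_le => // i _; have := dot_le_mean (col i A) y; rewrite dotA.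
by lra.
Qed.

(** * Relative width and progress of the iteration *)

Lemma width_ratio_le2 v i j : dot v (col i A - col j A) / enorm v <= 2.
Proof.
have [->|v0] := eqVneq v 0; first by rewrite dot0l mul0r.
rewrite ler_pdivrMr ?enorm_gt0 // mulrC.
apply: (le_trans (dot_le_enorm _ _)); rewrite ler_wpM2l ?enorm_ge0 //.
rewrite -(@ler_pXn2r _ 2) ?nnegrE ?enorm_ge0 // enorm_sqr !dotE !dotA.
have := dot_ge0 (col i A + col j A).
by rewrite !dotE !dotA (dotC (col j A)); lra.
Qed.

Lemma support_nonempty x :
  (forall i, 0 <= x i 0) -> A *m x != 0 -> exists i, support x i.
Proof.
move=> x0 Ax0; apply: contrapT => h; case/eqP: Ax0.
rewrite (_ : x = 0) ?mulmx0 //; apply/matrixP => i j.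
rewrite ord1 mxE; apply/eqP; rewrite eq_le x0 andbT leNgt.
by apply/negP => xi; apply: h; exists i.
Qed.

(** Taking l = j in the support gives the value 0, and Cauchy-Schwarz with |a_l - a_j| <= 2 bounds
    every value, so the [sup] is a genuine one and not a default. *)
Lemma width_at_bounds x : (forall i, 0 <= x i 0) -> A *m x != 0 ->
  0 <= width_at A x <= 2.
Proof.
move=> x0 Ax0; have [i xi] := support_nonempty x0 Ax0.
have i0 : [set r | exists l j, support x l /\
    r = dot (A *m x) (col l A - col j A) / enorm (A *m x)] 0.
  by exists i, i; split=> //; rewrite subrr dot0r mul0r.
have ub2 : ubound [set r | exists l j, support x l /\
    r = dot (A *m x) (col l A - col j A) / enorm (A *m x)] 2.
  by move=> r [l [j [_ ->]]]; exact: width_ratio_le2.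
apply/andP; split; last by apply: ge_sup => //; exists 0.
by apply: ub_le_sup i0; exists 2.
Qed.

Lemma relative_width_le_width_at x : (forall i, 0 <= x i 0) -> A *m x != 0 ->
  relative_width A <= width_at A x.
Proof.
move=> x0 Ax0; apply: ge_inf; last by exists x.
by exists 0 => r [z [z0 Az0] <-]; case/andP: (width_at_bounds z0 Az0).
Qed.

Lemma relative_width_bounds : 0 <= relative_width A <= 2.
Proof.
have [[x [x0 Ax0]]|none] :=
    pselect (exists x, (forall i, 0 <= x i 0) /\ A *m x != 0).
  apply/andP; split; last first.
    apply: le_trans (relative_width_le_width_at x0 Ax0) _.
    by case/andP: (width_at_bounds x0 Ax0).
  apply: lb_le_inf; first by exists (width_at A x), x.
  by move=> r [z [z0 Az0] <-]; case/andP: (width_at_bounds z0 Az0).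
(* Without any admissible x the infimum is over the empty set, where [inf] is 0 by convention. *)
rewrite /relative_width (_ : [set _ | _ in _] = set0) ?inf0 ?lexx ?ler0n //.
by apply/seteqP; split=> // r [x xP _]; case: none; exists x.
Qed.

(** The j and l selected by the algorithm maximize the ratio that defines [width_at]. *)
Lemma relative_width_le x j l : (forall i, 0 <= x i 0) ->
  (forall i, dot (col j A) (A *m x) <= dot (col i A) (A *m x)) ->
  (forall i, support x i -> dot (col i A) (A *m x) <= dot (col l A) (A *m x)) ->
  relative_width A * enorm (A *m x) <= dot (col l A - col j A) (A *m x).
Proof.
move=> x0 jP lP; have [->|Ax0] := eqVneq (A *m x) 0.
  by rewrite dot0r /enorm dot0l sqrtr0 mulr0.
rewrite -ler_pdivlMr ?enorm_gt0 //.
apply: le_trans (relative_width_le_width_at x0 Ax0) _.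
apply: ge_sup.
  have [i xi] := support_nonempty x0 Ax0.
  by exists (dot (A *m x) (col i A - col i A) / enorm (A *m x)), i, i.
move=> r [l' [j' [/lP ll' ->]]].
rewrite ler_pM2r ?invr_gt0 ?enorm_gt0 // dotC !(dotDl, dotNl).
by have := jP j'; lra.
Qed.

(** The left alternative is a step with full decrease, which may enlarge the support by one; the
    right one is an away step stopped at its maximal length, which removes l from the support. *)
Lemma vn_step_progress x x' :
  let y := A *m x in let y' := A *m x' in
  @simplex R n x -> ~~ halts A x -> vn_step A x x' ->
  @simplex R n x' /\
  ((exists p, [/\ relative_width A * enorm y / 2 <= p, dot y y <= p,
      dot y' y' <= dot y y - p ^+ 2 / 4 & (supp_card x' <= (supp_card x).+1)%N])
   \/ (supp_card x' < supp_card x)%N /\ dot y' y' <= dot y y).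
Proof.
move=> y y' xS nh [j [l [theta [jP xl lP step]]]].
have /simplexP[x0 x1] := xS.
have w := relative_width_le x0 jP lP; rewrite -/y in jP lP step w.
rewrite dotDl dotNl in w.
have aj0 : dot (col j A) y <= 0.
  move: nh; rewrite haltsE negb_forall => /existsP[i]; rewrite -leNgt.
  exact: le_trans.
have yy1 : dot y y <= 1 by exact: simplex_dot_le1.
have yal : dot y y <= dot (col l A) y by exact: dot_simplex_le.
have d4 i : dot (col i A - y) (col i A - y) <= 4.
  have := dot_ge0 (col i A + y).
  by rewrite !dotE !dotA (dotC y (col i A)); lra.
move: step; rewrite !(dotDl, dotNl); case: ifP => hlt [min x'E].
  have y'E : y' = y + theta *: (col j A - y).
    by rewrite /y' x'E mulmxDr -scalemxAr mulmxBr colE.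
  have /andP[t0 t1] := min.1.
  pose p := dot y y - dot (col j A) y.
  have p0 : 0 <= p by rewrite subr_ge0; have := dot_ge0 y; lra.
  have pE : dot (col j A - y) y = - p by rewrite dotDl dotNl opprB.
  split.
    apply/simplexP; rewrite x'E; split=> [i|].
      rewrite !mxE; have := x0 i; case: (i == j) => /=; nra.
    by rewrite sum_translate sum_ebasis x1; ring.
  (* The decrease rates of the two candidates add up to <a_l - a_j, y> >= w(A) |y|, so the larger
     one is at least half of that; [aj0] gives p >= |y|^2. *)
  left; exists p; split.
  - by rewrite /p; lra.
  - by rewrite /p; lra.
  (* A regular step is never cut short: that would need p > 4, while |a_j + y|^2 >= 0 and |y| <= 1
     give p <= 2. *)
  - have [[_ ]|] := line_min_decrease min (d4 j) p0 pE; last by rewrite -y'E.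
    have := dot_ge0 (col j A + y).
    by rewrite !dotE !dotA (dotC y (col j A)) /p; lra.
  - apply: (@leq_trans #|[predU1 j & [pred i | 0 < x i 0]]|); last first.
      by rewrite cardU1 -[leqRHS]add1n leq_add2r leq_b1.
    apply/subset_leq_card/(fintype.subsetP) => i; rewrite !inE x'E !mxE.
    by have := x0 i; case: eqVneq => //= _; nra.
have xl1 : x l 0 < 1.
  rewrite lt_neqAle simplex_le1 // andbT; apply/negP => /eqP xl1.
  move: hlt; rewrite /y (simplex_eq_ebasis xS xl1) -colE dotA subrr.
  by move: aj0; rewrite /y (simplex_eq_ebasis xS xl1) -colE => ? /negbT; lra.
have y'E : y' = y + theta *: (y - col l A).
  by rewrite /y' x'E mulmxDr -scalemxAr mulmxBr colE.
have /andP[t0 t1] := min.1.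
have tl : theta * (1 - x l 0) <= x l 0 by rewrite -ler_pdivlMr ?subr_gt0.
have x'l i : x' i 0 = x i 0 + theta * (x i 0 - (i == l)%:R).
  by rewrite x'E !mxE eqxx andbT.
(* An away step multiplies the entries other than l by 1 + theta and lowers entry l, so zero entries
   stay zero. *)
have sub : {subset [pred i | 0 < x' i 0] <= [pred i | 0 < x i 0]}.
  move=> i; rewrite !inE x'l => x'i; rewrite lt_def x0 andbT.
  by apply: contraTneq x'i => ->; case: (i == l) => /=; rewrite -leNgt; nra.
pose p := dot (col l A) y - dot y y.
have p0 : 0 <= p by rewrite subr_ge0.
have pE : dot (y - col l A) y = - p by rewrite dotDl dotNl opprB.
have d4' : dot (y - col l A) (y - col l A) <= 4.
  by rewrite -opprB dotNl dotNr opprK.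
have np : dot y y - dot (col j A) y <= p.
  by move/negbT: hlt; rewrite -leNgt /p; lra.
split.
  apply/simplexP; split=> [i|].
    rewrite x'l; have := x0 i.
    by case: (eqVneq i l) => [->|_] /=; [move=> _; lra | nra].
  by rewrite x'E sum_translate sum_ebasis x1; ring.
have [[tE _]|dec] := line_min_decrease min d4' p0 pE; last first.
  left; exists p; split; rewrite ?y'E //.
  - by move: np; rewrite /p; lra.
  - by lra.
  - by apply/leqW/subset_leq_card/fintype.subsetP.
(* At theta = x_l / (1 - x_l) the new entry l is exactly 0. *)
right; split; last by rewrite y'E (line_min_le min).
apply/proper_card/properP; split; first exact/fintype.subsetP.
exists l; rewrite !inE // x'l eqxx tE /=.
rewrite (_ : _ + _ = 0) ?ltxx //; field.
by rewrite subr_eq0 gt_eqF.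
Qed.

(** N counts the steps with full decrease. Such a step raises support size plus k by at most 2,
    matching the growth of 2N + 1; a cut-short away step does not raise it, since the support
    shrinks. Equality 1 + 0 = 1 is possible at the start. *)
Lemma vn_run_invariant x0 (x : nat -> 'cV[R]_n) k :
  let s i := dot (A *m x i) (A *m x i) in
  extreme_point (@simplex R n) x0 -> vn_run A x0 x ->
  (forall i, (i < k)%N -> ~~ halts A (x i)) ->
  @simplex R n (x k) /\
  exists N : nat, [/\ (supp_card (x k) + k <= N.*2.+1)%N, s k * N%:R <= 4
    & s k <= (1 - relative_width A ^+ 2 / 16) ^+ N * s 0%N].
Proof.
move=> s ex [x0E run]; elim: k => [_|k IH nh].
  split; first by rewrite x0E; exact: ex.1.
  exists 0%N; split.
  - by rewrite x0E addn0 extreme_supp_card.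
  - by rewrite mulr0.
  - by rewrite expr0 mul1r.
have [xS [N [cardN sN4 sNc]]] := IH (fun i ik => nh i (ltnW ik)).
have nhk := nh k (ltnSn k).
have := run k; rewrite (negPf nhk) => step.
have [x'S prog] := vn_step_progress xS nhk step; split=> //.
have s0 : 0 <= s k by exact: dot_ge0.
have s1 : s k <= 1 by exact: simplex_dot_le1.
have /andP[w0 w2] := relative_width_bounds.
case: prog => [[p [wp yp dec card']]|[card' dec]]; last first.
  exists N; split; first by lia.
  - by apply: le_trans sN4; rewrite ler_wpM2r.
  - exact: le_trans sNc.
exists N.+1; split; first by lia.
- have p2 : s k ^+ 2 <= p ^+ 2 by rewrite ler_pXn2r ?nnegrE // (le_trans s0 yp).
  have dec' : s k.+1 <= s k - s k ^+ 2 / 4 by apply: le_trans dec _; rewrite -/(s k); lra.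
  apply: (@le_trans _ _ ((s k - s k ^+ 2 / 4) * N.+1%:R)).
    by rewrite ler_wpM2r.
  (* This expression is four times the gap 4 - (s - s^2 / 4) (N + 1) with s = [s k]. *)
  have : 0 <= (4 - s k * N%:R) * (4 - s k) + s k ^+ 2.
    by rewrite addr_ge0 ?sqr_ge0 // mulr_ge0 // subr_ge0 // (le_trans s1) ?ler1n.
  by rewrite -(@natr1 _ N); lra.
- have wp0 : 0 <= relative_width A * enorm (A *m x k) / 2.
    by rewrite divr_ge0 // mulr_ge0 ?enorm_ge0.
  have : (relative_width A * enorm (A *m x k) / 2) ^+ 2 <= p ^+ 2.
    by rewrite ler_pXn2r ?nnegrE // (le_trans wp0 wp).
  rewrite expr_div_n exprMn enorm_sqr -/(s k) => p2.
  (* With p >= w(A) |y| / 2, the decrease p^2 / 4 is at least w(A)^2 |y|^2 / 16. *)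
  apply: (@le_trans _ _ ((1 - relative_width A ^+ 2 / 16) * s k)).
    by apply: le_trans dec _; rewrite -/(s k); lra.
  by rewrite (exprS _ N) -mulrA ler_wpM2l //; nra.
Qed.

(** * Halting, the condition measure and the distance from 0 to the hull *)

Lemma halts_margin x (i0 : 'I_n) : halts A x ->
  exists2 c, 0 < c & forall i, c <= dot (col i A) (A *m x).
Proof.
rewrite haltsE => /forallP pos.
have [j _ jP] := @arg_minP _ _ _ i0 xpredT (fun i => dot (col i A) (A *m x)) isT.
by exists (dot (col j A) (A *m x)) => // i; exact: jP.
Qed.

(** If A u = 0, the u-weighted average of the <a_i, A x> is 0, so they cannot share a positive lower
    bound. *)
Lemma conv_cols0_not_halts x : conv_cols A 0 -> ~~ halts A x.
Proof.
move=> [u uS uE]; apply/negP => h.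
have [i _] := simplex_index uS.
have [c c0 cP] := halts_margin i h.
by have := dot_simplex_ge uS cP; rewrite uE dot0l leNgt c0.
Qed.

Lemma dot_col_unit_le1 i v : enorm v = 1 -> -1 <= dot (col i A) v <= 1.
Proof.
move=> /enorm_eq1 v1; have := dot_le_mean (col i A) v.
by have := dot_le_mean (col i A) (- v); rewrite !dotE dotA v1; lra.
Qed.

Lemma min_dot_le i v : enorm v = 1 ->
  inf [set dot (col i A) v | i in [set: 'I_n]] <= dot (col i A) v.
Proof.
move=> v1; apply: ge_inf; last by exists i.
by exists (-1) => r [k _ <-]; case/andP: (dot_col_unit_le1 k v1).
Qed.

(** Weak duality: for a unit z, min_i <a_i, z> <= <A x, z> <= |A x|. *)
Lemma condition_measure_le_enorm x :
  @simplex R n x -> condition_measure A <= enorm (A *m x).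
Proof.
move=> xS; have [i _] := simplex_index xS; apply: ge_sup.
  by exists (inf [set dot (col k A) (col i A) | k in [set: 'I_n]]), (col i A).
move=> r [z /= z1 <-]; rewrite -[leRHS]mulr1 -z1.
apply: le_trans (dot_le_enorm _ _); apply: dot_simplex_ge => // k.
exact: min_dot_le.
Qed.

(** The witness z is A x normalized. Positivity matters because 8 / rho(A)^2 would be 0 by
    convention at rho(A) = 0. *)
Lemma halts_condition_measure_gt0 x :
  @simplex R n x -> halts A x -> 0 < condition_measure A.
Proof.
move=> xS h; have [i _] := simplex_index xS.
have [c c0 cP] := halts_margin i h.
have y0 : 0 < enorm (A *m x).
  rewrite enorm_gt0; apply: contraTneq (cP i) => ->.
  by rewrite dot0r -ltNge.
pose z := (enorm (A *m x))^-1 *: (A *m x).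
have z1 : enorm z = 1.
  rewrite /enorm /z dotZl dotZr -enorm_sqr expr2 mulKf ?gt_eqF //.
  by rewrite mulVf ?gt_eqF // sqrtr1.
apply: (@lt_le_trans _ _ (c / enorm (A *m x))); first by rewrite divr_gt0.
apply: (@le_trans _ _ (inf [set dot (col k A) z | k in [set: 'I_n]])).
  apply: lb_le_inf; first by exists (dot (col i A) z), i.
  by move=> r [k _ <-]; rewrite /z dotZr mulrC ler_pM2l ?invr_gt0.
apply: ub_le_sup; last by exists z.
exists 1 => r [v /= v1 <-]; apply: le_trans (min_dot_le i v1) _.
by case/andP: (dot_col_unit_le1 i v1).
Qed.

End Iteration.

(** The continuous function |A x|^2 attains its minimum on the compact simplex, and a zero minimum
    would put 0 in the hull. Transposes appear because [rV_compact] and [EVT_min_rV] concern row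
    vectors. *)
Lemma conv_cols_dist (R : realType) (m n : nat) (A : 'M[R]_(m, n)) u :
  @simplex R n u -> ~ conv_cols A 0 ->
  exists2 c, 0 < c & forall x, @simplex R n x -> c <= dot (A *m x) (A *m x).
Proof.
move=> uS nconv.
pose f (v : 'rV[R]_n) := dot (A *m v^T) (A *m v^T).
pose S : set 'rV[R]_n := [set v | @simplex R n v^T].
have sumC I (r : seq I) (F : I -> 'rV[R]_n -> R) :
    (forall i, continuous (F i)) -> continuous (fun v => \sum_(i <- r) F i v).
  move=> Fc; apply: continuous_big => [|i _]; last exact: Fc.
  exact: add_continuous.
have mulmxC i : continuous (fun v : 'rV[R]_n => (A *m v^T) i 0).
  under eq_fun do rewrite mxE.
  apply: sumC => j v; under eq_fun do rewrite mxE.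
  by apply: continuousM; [exact: cst_continuous | exact: coord_continuous].
have fC : continuous f.
  by apply: sumC => i v; apply: continuousM; exact: mulmxC.
have SK : compact S.
  (* The simplex is the section of the cube [0, 1]^n by a closed hyperplane. *)
  have -> : S = [set v : 'rV[R]_n | forall i, `[0, 1]%classic (v ord0 i)] `&`
      (fun v => \sum_i v 0 i) @^-1` [set 1].
    apply/seteqP; split=> v; rewrite /S /= => vS.
      have /simplexP[v0 v1] := vS; split=> [i|]; last first.
        by rewrite -v1; apply: eq_bigr => i _; rewrite mxE.
      by rewrite /= in_itv /=; have := v0 i; have := simplex_le1 i vS; rewrite mxE => -> ->.
    case: vS => v01 v1; apply/simplexP; split=> [i|].
      by rewrite mxE; have := v01 i; rewrite /= in_itv /= => /andP[].
    by rewrite -v1; apply: eq_bigr => i _; rewrite mxE.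
  apply: compact_closedI.
    apply: (@rV_compact R n (fun=> `[0, 1]%classic)) => _.
    exact: segment_compact.
  apply: preimage_closed; last exact: closed_eq.
  by move=> v _; apply: sumC => i; exact: coord_continuous.
have uT : S u^T by rewrite /S /= trmxK.
have [v] := EVT_min_rV (ex_intro _ _ uT) SK (continuous_subspaceT fC).
rewrite inE => vS vmin; exists (f v).
  rewrite lt_def dot_ge0 andbT dot_eq0; apply/eqP => Av0.
  by apply: nconv; exists v^T.
move=> x xS; have := vmin x^T; rewrite /f trmxK; apply.
by rewrite inE /S /= trmxK.
Qed.

(** * Assembly of the convergence rates and the iteration bound *)

Theorem theorem1 (R : realType) (m n : nat) (A : 'M[R]_(m, n))
    (hA : forall i, enorm (col i A) = 1)
    (x0 : 'cV[R]_n) (hx0 : extreme_point (@simplex R n) x0)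
    (x : nat -> 'cV[R]_n) (hx : vn_run A x0 x) :
  (conv_cols A 0 ->
     forall k : nat, (0 < k)%N ->
       @simplex R n (x k) /\
       enorm (A *m x k) ^+ 2 <=
         (1 - relative_width A ^+ 2 / 16) `^ (k%:R / 2)
           * enorm (A *m x 0%N) ^+ 2)
  /\
  (forall k : nat, (0 < k)%N -> (forall i : nat, (i < k)%N -> ~~ halts A (x i)) ->
     @simplex R n (x k) /\ enorm (A *m x k) ^+ 2 <= 8 / k%:R)
  /\
  (~ conv_cols A 0 ->
     exists k : nat, k%:R <= 8 / condition_measure A ^+ 2 /\ halts A (x k)).
Proof.
have inv k := @vn_run_invariant R m n A hA x0 x k hx0 hx.
(* A nonempty support absorbs the extra 1, leaving k <= 2N; hence s N <= 4 becomes s k <= 8. *)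
have card_bound k N : @simplex R n (x k) ->
    (supp_card (x k) + k <= N.*2.+1)%N -> (k <= N.*2)%N.
  by move=> /simplex_supp_gt0; lia.
have sublinear k : (0 < k)%N -> (forall i, (i < k)%N -> ~~ halts A (x i)) ->
    @simplex R n (x k) /\ enorm (A *m x k) ^+ 2 <= 8 / k%:R.
  move=> k0 nh; have [xS [N [cN sN _]]] := inv k nh; split=> //.
  have kN := card_bound _ _ xS cN.
  rewrite enorm_sqr ler_pdivlMr ?ltr0n //.
  apply: (@le_trans _ _ (dot (A *m x k) (A *m x k) * N.*2%:R)).
    by rewrite ler_wpM2l ?dot_ge0 // ler_nat.
  by rewrite -mul2n natrM; lra.
split=> [conv0 k k0|].
  have nh i (_ : (i < k)%N) := conv_cols0_not_halts (x i) conv0.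
  have [xS [N [cN _ sc]]] := inv k nh.
  split=> //; rewrite !enorm_sqr; apply: le_trans sc _.
  have /andP[w0 w2] := relative_width_bounds hA.
  have kN := card_bound _ _ xS cN.
  (* Since 0 <= w(A) <= 2, the base lies in [3/4, 1], and its powers decrease in the exponent; N >=
     k / 2 then suffices. *)
  have c01 : 0 < 1 - relative_width A ^+ 2 / 16 <= 1 by nra.
  rewrite ler_wpM2r ?dot_ge0 // -(@powR_mulrn _ _ N); last first.
    by case/andP: c01 => /ltW.
  apply: (ger_powR c01); rewrite ler_pdivrMr //.
  by rewrite -natrM ler_nat muln2.
split=> [//|nconv].
have [c c0 cP] := conv_cols_dist hx0.1 nconv.
(* A run that never halts would reach K > 8 / c, where |y_K|^2 <= 8 / K < c. *)
have [k hk] : exists k, halts A (x k).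
  apply: contrapT => /forallNP nh.
  have nh' i : ~~ halts A (x i) by apply/negP/nh.
  have := archi_boundP (ltW (divr_gt0 (ltr0n R 8) c0)).
  set K := Num.bound _ => cK.
  have K0 : (0 < K)%N.
    by rewrite -(ltr0n R); apply: le_lt_trans cK; rewrite divr_ge0 // ltW.
  have [xS] := sublinear K K0 (fun i _ => nh' i).
  rewrite enorm_sqr => /(le_trans (cP _ xS)).
  rewrite ler_pdivlMr ?ltr0n // mulrC -ler_pdivlMr // => /(lt_le_trans cK).
  by rewrite ltxx.
(* The first halting index is taken so that the 8 / k bound applies to it; then rho(A)^2 <= |y_k|^2
   <= 8 / k. *)
have [{hk}k hk kmin] := ex_minnP (ex_intro _ k hk : exists k, halts A (x k)).
have nh i : (i < k)%N -> ~~ halts A (x i).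
  by move=> ik; apply/negP => /kmin; rewrite leqNgt ik.
exists k; split=> //.
have [xS _] := inv k nh.
have rho0 := halts_condition_measure_gt0 hA xS hk.
case: (posnP k) => [->|k0]; first by rewrite divr_ge0 // sqr_ge0.
have [_ sk] := sublinear k k0 nh.
rewrite ler_pdivlMr ?exprn_gt0 // mulrC -ler_pdivlMr ?ltr0n //.
apply: le_trans sk; rewrite ler_pXn2r ?nnegrE ?enorm_ge0 ?(ltW rho0) //.
exact: condition_measure_le_enorm.
Qed.
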